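(* The greedy algorithm described in the context calculates a value $k_{\mathrm{ub}}$ with $$k_{\mathrm{ub}}\le(1+\ln(t))\,k_{\mathrm{opt}},$$ where $t=|\mathcal U|$ and $k_{\mathrm{opt}}$ is the minimum value of $k$ for which the two-stage robust problem and the $k$-adaptability problem (both without first-stage decisions) have the same optimal value.
   Context: Setting without first-stage decisions and with finite uncertainty: $\mathcal U=\{\xi^1,\ldots,\xi^t\}\subset\mathbb R^{n_\xi}$ consists of $t\ge1$ distinct scenarios, $\mathcal Y\subset\mathbb Z^{n_y}$ is finite, $g:\mathcal Y\times\mathcal U\to\mathbb R$, and $B(\xi)\in\mathbb R^{m\times n_y}$, $h(\xi)\in\mathbb R^m$ for $\xi\in\mathcal U$. The $k$-adaptability problem is $$\min_{y^1,\ldots,y^k\in\mathcal Y}\ \max_{\xi\in\mathcal U}\ \min_{\substack{i\in\{1,\ldots,k\}:\\ B(\xi)y^i\ge h(\xi)}} g(y^i,\xi)$$ (minimum over the empty set is $+\infty$; the $y^i$ need not be distinct), and the two-stage robust problem is this problem with $k=|\mathcal Y|$; its optimal value is $$v^*=\max_{\xi\in\mathcal U}\ \min_{y\in\mathcal Y:\ B(\xi)y\ge h(\xi)} g(y,\xi).$$ It is assumed that the two-stage robust problem is feasible, i.e. for every $\xi\in\mathcal U$ there is $y\in\mathcal Y$ with $B(\xi)y\ge h(\xi)$, so $v^*$ is finite. Greedy algorithm. Start with $\mathcal Y_{\mathrm{sol}}=\emptyset$ and $\mathcal U'=\mathcal U$. While $\mathcal U'\neq\emptyset$: compute an optimal solution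 $(y^*,z^* )$ of $$\begin{aligned}\max_{y,z}\ &\sum_{\xi\in\mathcal U'}z_\xi\\ \text{s.t. }& g(y,\xi)\le v^*+M(1-z_\xi)\quad\forall\xi\in\mathcal U',\\ & B(\xi)y\ge h(\xi)-M(1-z_\xi)\quad\forall\xi\in\mathcal U',\\ & y\in\mathcal Y,\ z\in\{0,1\}^{\mathcal U'},\end{aligned}$$ where $M$ is large enough that the constraints for $\xi$ are satisfied by every $y\in\mathcal Y$ whenever $z_\xi=0$ (the scalar $M(1-z_\xi)$ is subtracted from every component of $h(\xi)$); add $y^*$ to $\mathcal Y_{\mathrm{sol}}$; and remove from $\mathcal U'$ all $\xi$ with $z^*_\xi=1$. When $\mathcal U'=\emptyset$, return $k_{\mathrm{ub}}:=|\mathcal Y_{\mathrm{sol}}|$. *)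

(* Defs.v *)
From mathcomp Require Import all_boot all_order all_algebra finmap.
From mathcomp Require Import boolp reals constructive_ereal exp.

Set Implicit Arguments.
Unset Strict Implicit.
Unset Printing Implicit Defensive.

Import Order.TTheory GRing.Theory Num.Theory.

Local Open Scope ring_scope.
Local Open Scope fset_scope.

Definition cvle (R : realType) (m : nat) (u v : 'cV[R]_m) : bool :=
  [forall i, u i 0 <= v i 0].

(* [g], [B] and [h] are total functions, of which only the values at scenarios
   of [U] and decisions of [Y] are ever used. *)
Record problem (R : realType) (nxi ny m : nat) := Problem {
  U : {fset 'cV[R]_nxi};
  Y : {fset 'cV[int]_ny};
  g : 'cV[int]_ny -> 'cV[R]_nxi -> R;
  B : 'cV[R]_nxi -> 'M[R]_(m, ny);
  h : 'cV[R]_nxi -> 'cV[R]_m;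
  U_neq0 : U != fset0;
  two_stage_feasible : forall xi, xi \in U ->
    exists2 y, y \in Y & cvle (h xi) (B xi *m map_mx intr y) }.

Section Defs.
Variables (R : realType) (nxi ny m : nat) (P : problem R nxi ny m).

Definition second_stage_ok (y : 'cV[int]_ny) (xi : 'cV[R]_nxi) : bool :=
  cvle (h P xi) (B P xi *m map_mx intr y).

Local Open Scope ereal_scope.

Definition kadapt_objective (k : nat) (ys : {ffun 'I_k -> Y P}) : \bar R :=
  \big[maxe/-oo]_(xi <- U P)
    \big[mine/+oo]_(i < k | second_stage_ok (val (ys i)) xi)
      (g P (val (ys i)) xi)%:E.

Definition kadapt_value (k : nat) : \bar R :=
  \big[mine/+oo]_(ys : {ffun 'I_k -> Y P}) kadapt_objective ys.

Definition two_stage_value : \bar R := kadapt_value #|` Y P|.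

Definition vstar : \bar R :=
  \big[maxe/-oo]_(xi <- U P)
    \big[mine/+oo]_(y <- Y P | second_stage_ok y xi) (g P y xi)%:E.

Lemma two_stage_valueE : two_stage_value = vstar.
Proof.
apply/eqP; rewrite eq_le; apply/andP; split.
  pose ys := [ffun i : 'I_#|` Y P| => enum_val (cast_ord (cardfE (Y P)) i)].
  apply: (le_trans (bigmin_le _ ys _)).
  rewrite /kadapt_objective big_seq_cond.
  apply: bigmax_le => [|xi /andP[xiU _]]; first exact: leNye.
  apply: le_trans; last first.
    exact: (@le_bigmax_seq _ _ _ (U P) -oo xi xpredT).
  rewrite /=.
  rewrite [leRHS]big_seq_cond; apply: le_bigmin => [|y /andP[yY yok]].
    exact: bigmin_le_id.
  pose i := cast_ord (esym (cardfE (Y P))) (enum_rank [` yY]).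
  have ysi : val (ys i) = y by rewrite ffunE cast_ordKV enum_rankK.
  by apply: (@bigmin_inf _ _ _ _ i); rewrite ysi.
apply: le_bigmin => [|ys _]; first exact: leey.
rewrite /vstar big_seq_cond.
apply: bigmax_le => [|xi /andP[xiU _]]; first exact: leNye.
apply: le_trans; last exact: (@le_bigmax_seq _ _ _ (U P) -oo xi xpredT).
apply: le_bigmin => [|i iok]; first exact: leey.
by apply: ge_bigmin_seq; rewrite ?(valP (ys i)).
Qed.

Lemma kopt_exists : exists k, (0 < k)%N && (kadapt_value k == two_stage_value).
Proof.
exists #|` Y P|; rewrite eqxx andbT cardfs_gt0.
have /fset0Pn[xi /(@two_stage_feasible _ _ _ _ P)[y yY _]] := U_neq0 P.
by apply/fset0Pn; exists y.
Qed.

Definition kopt : nat := ex_minn kopt_exists.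

(* [vstar] is finite because the two-stage problem is feasible, so the sum below
   is an ordinary real sum. *)
Definition milp_constraint (M : R) (y : 'cV[int]_ny) (xi : 'cV[R]_nxi)
    (b : bool) : Prop :=
  (g P y xi)%:E <= vstar + (M * (1 - b%:R))%R%:E /\
  cvle (h P xi - const_mx (M * (1 - b%:R)))%R (B P xi *m map_mx intr y).

Definition large_enough (M : R) : Prop :=
  forall y xi, y \in Y P -> xi \in U P -> milp_constraint M y xi false.

Definition milp_feasible (M : R) (U' : {fset 'cV[R]_nxi})
    (y : 'cV[int]_ny) (z : {ffun U' -> bool}) : Prop :=
  y \in Y P /\ forall xi : U', milp_constraint M y (val xi) (z xi).

Definition milp_optimal (M : R) (U' : {fset 'cV[R]_nxi})
    (y : 'cV[int]_ny) (z : {ffun U' -> bool}) : Prop :=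
  milp_feasible M y z /\
  forall (y' : 'cV[int]_ny) (z' : {ffun U' -> bool}), milp_feasible M y' z' ->
    (\sum_(xi : U') z' xi <= \sum_(xi : U') z xi)%N.

Definition remaining (U' : {fset 'cV[R]_nxi}) (z : {ffun U' -> bool}) :
    {fset 'cV[R]_nxi} :=
  U' `\` [fset val xi | xi : U' & z xi].

(* The MILP may have several optimal solutions, so the algorithm is
   nondeterministic: [greedy_returns M Ysol U' n] says that some run of the loop
   from the state [(Ysol, U')] returns [n]. *)
Inductive greedy_returns (M : R) :
    {fset 'cV[int]_ny} -> {fset 'cV[R]_nxi} -> nat -> Prop :=
| Greedy_exit Ysol : greedy_returns M Ysol fset0 #|` Ysol|
| Greedy_iter Ysol (U' : {fset 'cV[R]_nxi}) y (z : {ffun U' -> bool}) n :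
    U' != fset0 -> milp_optimal M y z ->
    greedy_returns M (y |` Ysol) (remaining z) n ->
    greedy_returns M Ysol U' n.

(* From [U'], no run gets stuck (every MILP met has an optimal solution) and
   every run is finite, whichever optimal solutions are selected. *)
Inductive greedy_terminates (M : R) : {fset 'cV[R]_nxi} -> Prop :=
| Terminates_exit : greedy_terminates M fset0
| Terminates_iter (U' : {fset 'cV[R]_nxi}) :
    U' != fset0 ->
    (exists y (z : {ffun U' -> bool}), milp_optimal M y z) ->
    (forall y (z : {ffun U' -> bool}), milp_optimal M y z ->
       greedy_terminates M (remaining z)) ->
    greedy_terminates M U'.

End Defs.

(* Main.v *)
(** Decisions that are admissible with cost at most [vstar] at a scenario "cover"
    it; [kopt] decisions suffice to cover all of [U], and the MILP picks a
    decision covering the most remaining scenarios.  Each iteration therefore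
    covers at least a fraction [1 / kopt] of the [s] remaining scenarios, and
    [ln (s' / s) <= s' / s - 1 <= - 1 / kopt] shows that the potential
    [kopt * (1 + ln s)] drops by at least 1 until the last iteration. *)
Require Import Defs.
From mathcomp Require Import all_boot all_order all_algebra finmap.
From mathcomp Require Import boolp reals constructive_ereal exp.
Import Order.TTheory GRing.Theory Num.Theory.

Local Open Scope ring_scope.
Local Open Scope fset_scope.

Definition covers {R : realType} {nxi ny m : nat} (P : problem R nxi ny m)
    (y : 'cV[int]_ny) (xi : 'cV[R]_nxi) : bool :=
  second_stage_ok P y xi && ((g P y xi)%:E <= vstar P)%E.

(** This is where feasibility enters. Strictness makes [vstar] smaller than [+oo], the default of an
    empty minimum, in the comparisons of [kopt_cover]. *)
Lemma vstar_lty {R : realType} {nxi ny m : nat} (P : problem R nxi ny m) :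
  (vstar P < +oo)%E.
Proof.
rewrite /vstar big_seq_cond; apply: bigmax_lt => // xi /andP[xiU _].
have [y yY yok] := two_stage_feasible xiU.
apply: (@le_lt_trans _ _ (g P y xi)%:E); last exact: ltry.
exact: ge_bigmin_seq.
Qed.

Lemma kopt_spec {R : realType} {nxi ny m : nat} (P : problem R nxi ny m) :
  (0 < kopt P)%N /\ kadapt_value P (kopt P) = vstar P.
Proof.
rewrite /kopt; case: ex_minnP => k /andP[k_gt0 /eqP ->] _.
by rewrite two_stage_valueE.
Qed.

(** A minimum over finitely many families is attained, so some family has objective at most [vstar];
    a scenario covered by none of its members would push that objective above [vstar]. *)
Lemma kopt_cover {R : realType} {nxi ny m : nat} (P : problem R nxi ny m) :
  exists ys : {ffun 'I_(kopt P) -> Y P},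
    forall xi, xi \in U P -> exists i, covers P (val (ys i)) xi.
Proof.
have [_ valE] := kopt_spec P.
have [/existsP[ys obj_le]|] := boolP
  [exists ys : {ffun 'I_(kopt P) -> Y P}, (kadapt_objective ys <= vstar P)%E].
  exists ys => xi xiU; apply/existsP; apply: contraTT obj_le.
  rewrite negb_exists -ltNge => /forallP noi.
  apply: lt_le_trans; last exact: (@le_bigmax_seq _ _ _ (U P) _ xi).
  apply: lt_bigmin => [|i iok]; first exact: vstar_lty.
  by have := noi i; rewrite /covers iok -ltNge.
rewrite negb_exists => /forallP obj_gt.
suff: (vstar P < kadapt_value P (kopt P))%E by rewrite valE ltxx.
apply: lt_bigmin => [|ys _]; first exact: vstar_lty.
by rewrite ltNge obj_gt.
Qed.

Lemma milp_constraint_true {R : realType} {nxi ny m : nat}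
    (P : problem R nxi ny m) (M : R) (y : 'cV[int]_ny) (xi : 'cV[R]_nxi) :
  milp_constraint P M y xi true <-> covers P y xi.
Proof.
rewrite /milp_constraint subrr mulr0 adde0.
have -> : (h P xi - const_mx 0) = h P xi by apply/matrixP => i j; rewrite !mxE subr0.
by rewrite /covers; split=> [[? ?]|/andP[? ?]]; [apply/andP|].
Qed.

(** The term in [M] vanishes where [z] is 1, and a large [M] makes the constraints vacuous where [z]
    is 0. *)
Lemma milp_feasibleP {R : realType} {nxi ny m : nat} (P : problem R nxi ny m)
    (M : R) (hM : large_enough P M) (U' : {fset 'cV[R]_nxi}) (sU : U' `<=` U P)
    (y : 'cV[int]_ny) (z : {ffun U' -> bool}) :
  milp_feasible P M y z <->
  y \in Y P /\ forall xi : U', z xi -> covers P y (val xi).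
Proof.
split=> -[yY yz]; split=> // xi.
  by move=> zxi; apply/(milp_constraint_true P M); rewrite -zxi.
have := yz xi; case: (z xi) => [/(_ isT)|_].
  by move/(milp_constraint_true P M).
by apply: hM => //; apply: (fsubsetP sU); apply: valP.
Qed.

(** Double counting: each of the [kopt P] covering decisions, paired with the indicator of what it
    covers in [U'], is feasible and so counts at most the optimum, while together they reach every
    scenario of [U']. *)
Lemma milp_optimal_card {R : realType} {nxi ny m : nat} (P : problem R nxi ny m)
    (M : R) (hM : large_enough P M) (U' : {fset 'cV[R]_nxi}) (sU : U' `<=` U P)
    (y : 'cV[int]_ny) (z : {ffun U' -> bool}) :
  milp_optimal P M y z -> (#|` U'| <= kopt P * \sum_(xi : U') z xi)%N.
Proof.
case=> _ zmax; have [ys ysP] := kopt_cover P.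
pose c (i : 'I_(kopt P)) := [ffun xi : U' => covers P (val (ys i)) (val xi)].
apply: (@leq_trans (\sum_(xi : U') \sum_i c i xi)).
  rewrite cardfE -sum1_card leq_sum // => xi _.
  have [i ci] := ysP _ (fsubsetP sU _ (valP xi)).
  by rewrite (bigD1 i) //= ffunE ci.
rewrite exchange_big -[X in (_ <= X * _)%N]card_ord -sum_nat_const /=.
apply: leq_sum => i _; apply: zmax (val (ys i)) (c i) _.
apply/milp_feasibleP => //; split=> [|xi]; first exact: valP.
by rewrite ffunE.
Qed.

(** For a fixed decision the best [z] is the indicator [c y] of the scenarios it covers, which
    leaves a maximum over the finite set [Y P]. *)
Lemma milp_optimal_exists {R : realType} {nxi ny m : nat}
    (P : problem R nxi ny m) (M : R) (hM : large_enough P M)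
    (U' : {fset 'cV[R]_nxi}) (sU : U' `<=` U P) :
  exists y (z : {ffun U' -> bool}), milp_optimal P M y z.
Proof.
have [k_gt0 _] := kopt_spec P; have [ys _] := kopt_cover P.
pose c (y : Y P) := [ffun xi : U' => covers P (val y) (val xi)].
(* The first member of a covering family witnesses that [Y P] is nonempty. *)
case: (@arg_maxnP _ (ys (Ordinal k_gt0)) xpredT
  (fun y => \sum_(xi : U') c y xi)%N isT) => y _ ymax.
exists (val y), (c y); split=> [|y' z' /(milp_feasibleP _ _ hM _ sU)[y'Y y'z]].
  by apply/milp_feasibleP => //; split=> [|xi]; rewrite ?ffunE //; exact: valP.
apply: leq_trans (ymax [` y'Y] isT); apply: leq_sum => xi _; rewrite ffunE /=.
by case: (z' xi) (y'z xi) => // ->.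
Qed.

Lemma remaining_sub {R : realType} {nxi : nat} (U' : {fset 'cV[R]_nxi})
    (z : {ffun U' -> bool}) : remaining z `<=` U'.
Proof. exact: fsubsetDl. Qed.

Lemma card_remaining {R : realType} {nxi : nat} (U' : {fset 'cV[R]_nxi})
    (z : {ffun U' -> bool}) :
  (#|` remaining z| + \sum_(xi : U') z xi)%N = #|` U'|.
Proof.
rewrite -(cardfsID [fset val xi | xi : U' & z xi] U') addnC; congr addn.
have /fsetIidPr -> : [fset val xi | xi : U' & z xi] `<=` U'.
  by apply/fsubsetP => _ /imfsetP[xi _ ->]; apply: valP.
rewrite card_imfset; last exact: val_inj.
transitivity (size (enum [pred xi | z xi])).
  rewrite -cardE -sum1_card [RHS]big_mkcond; apply: eq_bigr => xi _.
  by rewrite inE; case: (z xi).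
apply/perm_size/uniq_perm; rewrite ?enum_uniq ?enum_finmem_uniq // => xi.
by rewrite mem_enum enum_finmemE.
Qed.

(** By [milp_optimal_card] the optimum is positive while scenarios remain, so their number strictly
    decreases. *)
Lemma greedy_terminates_sub {R : realType} {nxi ny m : nat}
    (P : problem R nxi ny m) (M : R) (hM : large_enough P M)
    (U' : {fset 'cV[R]_nxi}) :
  U' `<=` U P -> greedy_terminates P M U'.
Proof.
have [s] := ubnP #|` U'|; elim: s U' => // s IH U' ltU' sU.
have [->|U'neq0] := eqVneq U' fset0; first exact: Terminates_exit.
apply: Terminates_iter => //; first exact: milp_optimal_exists.
move=> y z yz; apply: IH; last exact: fsubset_trans (remaining_sub _ z) sU.
rewrite -(card_remaining _ z) in ltU'.
have := milp_optimal_card P M hM U' sU y z yz.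
have := U'neq0; rewrite -cardfs_gt0.
case: (\sum_(xi : U') z xi)%N ltU' => [_|p]; first by rewrite muln0 leqn0 lt0n => /negPf ->.
by rewrite addnS ltnS => lt_s _ _; apply: leq_ltn_trans lt_s; apply: leq_addr.
Qed.

Lemma ln_potential_drop {R : realType} (k s s' : nat) :
  (0 < s')%N -> (s' <= s)%N -> (s <= k * (s - s'))%N ->
  (1 + k%:R * ln s'%:R <= k%:R * ln s%:R :> R)%R.
Proof.
move=> s'_gt0 les cover.
have s_gt0 : 0 < s%:R :> R by rewrite ltr0n (leq_trans s'_gt0).
have s'R_gt0 : 0 < s'%:R :> R by rewrite ltr0n.
have ln_le : ln s'%:R - ln s%:R <= s'%:R / s%:R - 1 :> R.
  (* The bound [ln (1 + x) <= x] is applied at [x = s' / s - 1], which exceeds -1 because [s'] is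
     positive. *)
  rewrite -ln_div ?posrE // -[X in ln X](subrK 1) addrC.
  by apply: le_ln1Dx; rewrite ltrBrDr addNr divr_gt0.
rewrite -lerBrDr -mulrBr -opprB mulrN lerNr.
apply: (le_trans (ler_wpM2l (ler0n _ k) ln_le)).
have -> : s'%:R / s%:R - 1 = - ((s - s')%:R / s%:R) :> R.
  by rewrite natrB // mulrBl divff ?gt_eqF // opprB.
by rewrite mulrN lerN2 mulrA ler_pdivlMr // mul1r -natrM ler_nat.
Qed.

(** Induction on the run; the potential is set to 0 once no scenario remains, since nothing is added
    any more. *)
Lemma greedy_returns_le {R : realType} {nxi ny m : nat}
    (P : problem R nxi ny m) (M : R) (hM : large_enough P M)
    (Ysol : {fset 'cV[int]_ny}) (U' : {fset 'cV[R]_nxi}) (n : nat) :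
  greedy_returns P M Ysol U' n -> U' `<=` U P ->
  (n%:R <= #|` Ysol|%:R +
    (if U' == fset0 then 0 else (1 + ln #|` U'|%:R) * (kopt P)%:R) :> R)%R.
Proof.
elim=> {Ysol U' n} [Ysol _|Ysol U' y z n U'neq0 yz _ IH sU].
  by rewrite eqxx addr0.
rewrite (negPf U'neq0).
have cover := milp_optimal_card P M hM U' sU y z yz.
have cardE := card_remaining U' z.
apply: (le_trans (IH (fsubset_trans (remaining_sub _ z) sU))).
have -> : (#|` Ysol|%:R + (1 + ln #|` U'|%:R) * (kopt P)%:R =
    #|` Ysol|%:R + 1 + ((1 + ln #|` U'|%:R) * (kopt P)%:R - 1) :> R)%R.
  by rewrite addrACA subrr addr0.
apply: lerD.
  (* Only an inequality, as [y] might already lie in [Ysol]. *)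
  by rewrite natr1 ler_nat cardfsU1 -[leqRHS]add1n leq_add2r leq_b1.
have [k_gt0 _] := kopt_spec P.
have k_ge1 : 1 <= (kopt P)%:R :> R by rewrite ler1n.
(* In the last iteration the potential falls to 0 from at least [kopt P >= 1], which pays for the
   added decision; otherwise [ln_potential_drop] applies. *)
rewrite lerBrDl; case: eqP => [_|/eqP rem_neq0].
  rewrite addr0 mulrDl mul1r (le_trans k_ge1) // lerDl mulr_ge0 ?ler0n //.
  by apply: ln_ge0; rewrite ler1n cardfs_gt0.
rewrite !mulrDl mul1r addrCA lerD2l ![_ * (kopt P)%:R]mulrC.
apply: ln_potential_drop; first by rewrite cardfs_gt0.
  by rewrite -cardE leq_addr.
by rewrite -[in X in (_ <= _ * X)%N]cardE addKn.
Qed.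

Theorem theorem30 (R : realType) (nxi ny m : nat) (P : problem R nxi ny m)
    (M : R) (hM : large_enough P M) :
  greedy_terminates P M (U P) /\
  forall kub : nat, greedy_returns P M fset0 (U P) kub ->
    kub%:R <= (1 + ln (#|` U P|%:R : R)) * (kopt P)%:R.
Proof.
split=> [|kub ret]; first exact: greedy_terminates_sub.
have := greedy_returns_le P M hM _ _ _ ret (fsubset_refl _).
by rewrite (negPf (U_neq0 P)) cardfs0 add0r.
Qed.
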